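(* Let $n\ge 2$ and let $\mathcal{D}\subseteq\binom{[n]}{2}$. Then $\mathcal{D}^c$ is a positroid if and only if $\mathcal{D}$ is nice, i.e. if and only if both of the following hold: (1) every connected component of the graph $G_{\mathcal{D}}$ is complete; (2) there is no connected component $C$ of $G_{\mathcal{D}}$ such that $P_{n,T_{\mathcal{D}}}\setminus C$ is disconnected.
   Context: $[n]=\{1,\dots,n\}$ is cyclically ordered, $\binom{[n]}{2}$ is the set of 2-element subsets of $[n]$, and $\mathcal{D}^c=\binom{[n]}{2}\setminus\mathcal{D}$. A collection $\mathcal{I}\subseteq\binom{[n]}{2}$ is a positroid if there is a real $2\times n$ matrix $A$ such that, for $I=\{i<j\}$, the minor $\det A[I]$ on columns $i,j$ (in this order) is $>0$ if $I\in\mathcal{I}$ and $=0$ if $I\notin\mathcal{I}$. (In particular the empty collection counts as a positroid.) For $\mathcal{D}\subseteq\binom{[n]}{2}$, put $T_{\mathcal{D}}=\{i\in[n] : \{i,j\}\in\mathcal{D}\text{ for all }j\in[n]\setminus\{i\}\}$, and let $G_{\mathcal{D}}$ be the simple graph with vertex set $[n]\setminus T_{\mathcal{D}}$ and edge set $\{\{i,j\}\in\mathcal{D} : i,j\in[n]\setminus T_{\mathcal{D}}\}$. For $T\subseteq[n]$, $P_{n,T}$ is the polygon (cycle graph) with vertex set $[n]\setminus T$, whose edges join cyclically consecutive elements of $[n]\setminus T$. For a subgraph $C$ with vertices in $[n]\setminus T$, $P_{n,T}\setminus C$ is the graph obtained from $P_{n,T}$ by deleting the vertices of $C$ (and all incident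 edges). The empty graph and a single vertex are regarded as connected. *)

(* Defs.v *)
From HB Require Import structures.
From mathcomp Require Import all_boot all_order all_algebra.
From mathcomp Require Import reals.

Set Implicit Arguments.
Unset Strict Implicit.
Unset Printing Implicit Defensive.

Import Order.TTheory GRing.Theory Num.Theory.

Local Open Scope ring_scope.

Definition pairs (T : finType) : {set {set T}} := [set e : {set T} | #|e| == 2%N].

Definition minor2 (R : realType) (n : nat) (A : 'M[R]_(2, n)) (i j : 'I_n) : R :=
  \det (colsub (tnth [tuple i; j]) A).

Definition positroid (R : realType) (n : nat) (B : {set {set 'I_n}}) : Prop :=
  B \subset pairs 'I_n /\
  exists A : 'M[R]_(2, n), forall i j : 'I_n, (i < j)%N ->
    ([set i; j] \in B -> 0 < minor2 A i j) /\
    ([set i; j] \notin B -> minor2 A i j = 0).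

Record sgraph (T : finType) := SGraph {
  vertices : {set T};
  edges : {set {set T}};
  edges_pairs : edges \subset pairs T;
  edges_vertices : {in edges, forall e : {set T}, e \subset vertices}
}.

Definition adj (T : finType) (G : sgraph T) : rel T :=
  fun x y => [set x; y] \in edges G.

Definition connected (T : finType) (G : sgraph T) : Prop :=
  {in vertices G &, forall x y, connect (adj G) x y}.

(* A connected component is an induced subgraph; it is represented by its
   (nonempty) vertex set. *)
Definition components (T : finType) (G : sgraph T) : {set {set T}} :=
  equivalence_partition (connect (adj G)) (vertices G).

Definition complete_on (T : finType) (G : sgraph T) (C : {set T}) : Prop :=
  {in C &, forall x y, x != y -> adj G x y}.

Definition induced_edges (T : finType) (E : {set {set T}}) (V : {set T}) :
    {set {set T}} :=
  [set e in E | (e \in pairs T) && (e \subset V)].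

Lemma induced_edges_pairs (T : finType) (E : {set {set T}}) (V : {set T}) :
  induced_edges E V \subset pairs T.
Proof. by apply/subsetP => e; rewrite inE => /and3P[]. Qed.

Lemma induced_edges_vertices (T : finType) (E : {set {set T}}) (V : {set T}) :
  {in induced_edges E V, forall e : {set T}, e \subset V}.
Proof. by move=> e; rewrite inE => /and3P[]. Qed.

Definition graph_on (T : finType) (E : {set {set T}}) (V : {set T}) : sgraph T :=
  SGraph (induced_edges_pairs E V) (@induced_edges_vertices T E V).

Definition delete_vertices (T : finType) (G : sgraph T) (C : {set T}) : sgraph T :=
  graph_on (edges G) (vertices G :\: C).

Definition universal_elements (n : nat) (D : {set {set 'I_n}}) : {set 'I_n} :=
  [set i | [forall j, (j != i) ==> ([set i; j] \in D)]].

Definition graph_of (n : nat) (D : {set {set 'I_n}}) : sgraph 'I_n :=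
  graph_on D (~: universal_elements D).

(* [enum (~: T)] lists the complement of [T] in increasing order, so [next]
   gives the cyclic successor within it.  When [~: T] is a singleton the only
   candidate [[set x; x]] is not a pair, hence [graph_on] drops it. *)
Definition polygon (n : nat) (T : {set 'I_n}) : sgraph 'I_n :=
  graph_on [set [set x; next (enum (~: T)) x] | x in ~: T] (~: T).

Definition nice (n : nat) (D : {set {set 'I_n}}) : Prop :=
  (forall C, C \in components (graph_of D) -> complete_on (graph_of D) C) /\
  ~ (exists C, C \in components (graph_of D) /\
       ~ connected (delete_vertices (polygon (universal_elements D)) C)).

(* Main.v *)
Require Import Defs.
From mathcomp Require Import all_boot all_order all_algebra.
From mathcomp Require Import reals.
From mathcomp Require Import zify ring.

(** Nonzero columns of a 2-row matrix are in the same parallel class exactly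
    when their minor vanishes, so the components of [graph_of D] are the
    parallel classes.  The Plücker relation
    p_ac p_bd = p_ab p_cd + p_ad p_bc with nonnegative minors says that no
    class separates two points of its complement on the polygon, which is
    connectedness after deletion.  Conversely, let C0 be the class of the
    smallest non-universal element; it is an initial segment together with a
    final segment, which get the columns (1,0) and (-1,0), and every other
    element i gets (-m, 1), where m is the least element of its class. *)

Set Implicit Arguments.
Unset Strict Implicit.
Unset Printing Implicit Defensive.

Import Order.TTheory GRing.Theory Num.Theory.

Local Open Scope ring_scope.

(** * Unordered pairs and cyclic successors *)

Lemma set2_eq (T : finType) (x y a b : T) :
  [set x; y] = [set a; b] -> (x = a /\ y = b) \/ (x = b /\ y = a).
Proof.
move=> E.
have : x \in [set a; b] by rewrite -E set21.
have : y \in [set a; b] by rewrite -E set22.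
have : a \in [set x; y] by rewrite E set21.
have : b \in [set x; y] by rewrite E set22.
rewrite !inE => /orP[]/eqP-> /orP[]/eqP-> /orP[]/eqP ? /orP[]/eqP ?; subst; auto.
Qed.

Lemma adj_sym (T : finType) (G : sgraph T) : symmetric (adj G).
Proof. by move=> x y; rewrite /adj setUC. Qed.

Lemma sorted_enum_ord (n : nat) (S : {set 'I_n}) :
  sorted (fun i j : 'I_n => (i < j)%N) (enum S).
Proof.
rewrite /enum_mem sorted_filter //; first by move=> x y z; apply: ltn_trans.
by rewrite -enumT -(sorted_map (f:=val) (e':=ltn)) val_enum_ord iota_ltn_sorted.
Qed.

(** The second alternative is the wrap-around from the maximum of [S] to its minimum; it includes a
    singleton [S]. *)
Lemma next_enumP (n : nat) (S : {set 'I_n}) (x : 'I_n) : x \in S ->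
  next (enum S) x \in S /\
  [\/ (x < next (enum S) x)%N /\
      {in S, forall z : 'I_n, (x < z)%N -> (next (enum S) x <= z)%N}
    | {in S, forall z : 'I_n, (z <= x)%N /\ (next (enum S) x <= z)%N}].
Proof.
move=> xS; split; first by rewrite -mem_enum mem_next mem_enum.
have tr : transitive (fun i j : 'I_n => (i < j)%N).
  by move=> a b c; apply: ltn_trans.
have nthS := sorted_ltn_nth tr x (sorted_enum_ord S).
have mono i j : (i <= j)%N -> (j < size (enum S))%N ->
    (nth x (enum S) i <= nth x (enum S) j)%N.
  rewrite leq_eqVlt => /orP[/eqP->//|ij jS].
  by apply/ltnW/nthS; rewrite ?inE // (ltn_trans ij).
have zE (z : 'I_n) : z \in S ->
    exists2 j, (j < size (enum S))%N & z = nth x (enum S) j.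
  move=> zS; exists (index z (enum S)); last by rewrite nth_index // mem_enum.
  by rewrite index_mem mem_enum.
have xs : (index x (enum S) < size (enum S))%N by rewrite index_mem mem_enum.
have xN : nth x (enum S) (index x (enum S)) = x by rewrite nth_index // mem_enum.
have nE : next (enum S) x =
    nth x (enum S) (if ((index x (enum S)).+1 < size (enum S))%N
                    then (index x (enum S)).+1 else 0).
  (* [next] looks up the tail of the list with the head as default value, so the lookup past the end
     is the wrap-around. *)
  rewrite next_nth mem_enum xS; case: (enum S) xs => //= y s xs.
  set i := if y == x then 0%N else _ in xs *.
  rewrite ltnS; case: ltnP => H /=; first exact: set_nth_default.
  by rewrite nth_default.
case: ltnP nE => H ->; [left|right].
  split; first by have := nthS _ _ xs H (ltnSn _); rewrite xN.
  move=> z /zE[j js ->] lt_xj; apply: (mono _ j) => //; rewrite ltnNge.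
  by apply/negP => /mono/(_ xs); rewrite xN leqNgt lt_xj.
move=> z /zE[j js ->]; split; last exact: mono.
have := mono j (index x (enum S)); rewrite xN; apply => //.
by rewrite -ltnS (leq_trans js).
Qed.

(** Comparing memberships, rather than naming the points of [C], covers alternations that start
    inside [C] and those that start outside. *)
Definition noncrossing (n : nat) (V C : {set 'I_n}) : Prop :=
  forall a b c d, a \in V -> b \in V -> c \in V -> d \in V ->
    (a < b < c)%N -> (c < d)%N ->
    ~~ [&& (a \in C) == (c \in C), (b \in C) == (d \in C)
         & (a \in C) != (b \in C)].

(** * Connectedness of the polygon after deletion *)

Section PolygonDeletion.

Variables (n : nat) (T C : {set 'I_n}).

Let P := delete_vertices (polygon T) C.

Lemma adj_next (x : 'I_n) : x \in ~: T :\: C ->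
  next (enum (~: T)) x \in ~: T :\: C -> x != next (enum (~: T)) x ->
  adj P x (next (enum (~: T)) x).
Proof.
set y := next _ _ => xV yV xy; rewrite /adj !inE.
have [xT yT] : x \in ~: T /\ y \in ~: T by move/setDP: xV; move/setDP: yV => [-> _][-> _].
rewrite cards2 xy /= !subUset !sub1set /= xV yV xT yT !andbT /=.
by apply/imsetP; exists x.
Qed.

Lemma adj_polygonP (x y : 'I_n) : adj P x y ->
  [/\ x \in ~: T :\: C, y \in ~: T :\: C &
      y = next (enum (~: T)) x \/ x = next (enum (~: T)) y].
Proof.
rewrite /adj => /setIdP[/setIdP[/imsetP[z zT E] _] /andP[_]].
rewrite subUset !sub1set /= => /andP[xV yV]; split=> //.
by case: (set2_eq E) => -[hx hy]; subst; auto.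
Qed.

Lemma connect_segment (x y : 'I_n) : x \in ~: T -> y \in ~: T -> (x <= y)%N ->
  (forall z, z \in ~: T -> (x <= z <= y)%N -> z \notin C) ->
  connect (adj P) x y.
Proof.
move=> + yT; move: {2}(y - x)%N (leqnn (y - x)%N) => k.
elim: k x => [|k IH] x xyk xT xy seg.
  by have -> : x = y by apply/val_inj => /=; lia.
have [->//|neq_xy] := eqVneq x y.
have lt_xy : (x < y)%N by rewrite ltn_neqAle neq_xy.
have [nT [[lt_xn min_n]|/(_ y yT)]] := next_enumP xT; last by lia.
have le_ny := min_n y yT lt_xy.
apply: connect_trans (connect1 (adj_next _ _ _)) (IH _ _ nT le_ny _).
- by rewrite inE xT seg ?andbT // leqnn ltnW.
- by rewrite inE nT seg ?andbT // le_ny ltnW.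
- by rewrite neq_ltn lt_xn.
- lia.
- by move=> z zT /andP[nz zy]; apply: seg; rewrite // zy andbT; lia.
Qed.

(** The open interval from [p] to [q] is closed under adjacency, since leaving it would mean passing
    through a deleted vertex. *)
Lemma separated_disconnected (p q x y : 'I_n) :
  p \in ~: T -> q \in ~: T -> p \in C -> q \in C ->
  x \in ~: T :\: C -> y \in ~: T :\: C ->
  (p < x < q)%N -> ~~ (p < y < q)%N -> ~ connected P.
Proof.
move=> pT qT pC qC xV yV xpq /negP ypq conn.
have clo : closed (adj P) [pred z : 'I_n | (p < z < q)%N].
  apply: intro_closed; first exact/sym_connect_sym/adj_sym.
  move=> z w /adj_polygonP[/setDP[zT zC] /setDP[wT wC] zw]; rewrite !inE => /andP[pz zq].
  have neq (a b : 'I_n) : a \in C -> b \notin C -> a != b :> nat.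
    by move=> aC bC; apply: contraNneq bC => /val_inj <-.
  have pw := neq _ _ pC wC; have qw := neq _ _ qC wC.
  (* A step to the successor cannot jump over [q], nor a step back over [p]; [q] above [z] and [p]
     below it rule out the wrap-around. *)
  case: zw => E.
    by have [_] := next_enumP zT; rewrite -E => -[[zw /(_ q qT zq)]|/(_ q qT)]; lia.
  by have [_] := next_enumP wT; rewrite -E => -[[wz /(_ p pT)]|/(_ p pT)]; lia.
apply: ypq; have := closed_connect clo (conn x y xV yV).
by rewrite !inE xpq => <-.
Qed.

Lemma connected_polygonP : connected P <-> noncrossing (~: T) C.
Proof.
split=> [conn a b c d aT bT cT dT /andP[ab bc] cd|ncr].
  apply/negP => /and3P[/eqP ac /eqP bd].
  have inV z : z \in ~: T -> z \notin C -> z \in ~: T :\: C.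
    by rewrite in_setD => -> ->.
  case: (boolP (a \in C)) ac => aC /esym cC; case: (boolP (b \in C)) bd => bC /esym dC // _.
    by apply: (separated_disconnected aT cT aC cC (inV b _ _) (inV d _ _)) conn;
      rewrite ?dC //; lia.
  by apply: (separated_disconnected bT dT bC dC (inV c _ _) (inV a _ _)) conn;
    rewrite ?cC //; lia.
have symc := sym_connect_sym (@adj_sym _ P).
have main (x y : 'I_n) : x \in ~: T :\: C -> y \in ~: T :\: C -> (x <= y)%N ->
    connect (adj P) x y.
  move=> /setDP[xT xC] /setDP[yT yC] xy.
  case: (boolP [exists c in ~: T :&: C, (x < c < y)%N]) => [|/existsP sepN]; last first.
    apply: connect_segment => // z zT xzy; apply/negP => zC; apply: sepN; exists z.
    rewrite !inE zC -in_setC zT /=.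
    have : x != z :> nat by apply: contraNneq xC => /val_inj ->.
    have : y != z :> nat by apply: contraNneq yC => /val_inj ->.
    lia.
  case/existsP=> c /andP[/setIP[cT cC] /andP[xc cy]].
  (* With [c] in [C] between [x] and [y], a point of [C] outside would alternate with them, so the
     way round the outside is free. *)
  have outer (z : 'I_n) : z \in ~: T -> (z <= x)%N || (y <= z)%N -> z \notin C.
    move=> zT zout; apply/negP => zC.
    have zx : x != z :> nat by apply: contraNneq xC => /val_inj ->.
    have zy : y != z :> nat by apply: contraNneq yC => /val_inj ->.
    case/orP: zout => H.
      have := ncr z x c y zT xT cT yT; rewrite zC (negbTE xC) cC (negbTE yC) /=; lia.
    have := ncr x c y z xT cT yT zT; rewrite zC (negbTE xC) cC (negbTE yC) /=; lia.
  (* The path climbs from [y] to the maximum [m], wraps around to the minimum [k], and climbs to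
     [x]. *)
  pose m := [arg max_(i > x in ~: T) (i : nat)].
  have [mT mmax] : m \in ~: T /\ {in ~: T, forall z : 'I_n, (z <= m)%N}.
    by rewrite /m; case: arg_maxnP => // i iT H.
  have [nT [[lt_mn _]|nmin]] := next_enumP mT.
    by have := mmax _ nT; rewrite leqNgt lt_mn.
  set k := next _ m in nT nmin.
  have [_ kx] := nmin _ xT; have my := mmax _ yT.
  have km : m != k by apply/eqP => E; move: (mmax _ yT) kx xc cy; rewrite E; lia.
  rewrite symc; apply: connect_trans (connect_segment yT mT my _) _.
    by move=> z zT /andP[yz _]; apply: outer => //; rewrite yz orbT.
  apply: connect_trans (connect1 (adj_next _ _ km)) _.
  - by rewrite inE mT outer // my orbT.
  - by rewrite inE nT outer // kx.
  - apply: connect_segment => // z zT /andP[_ zx]; apply: outer => //.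
    by rewrite zx.
move=> x y xV yV; case: (leqP x y) => [|/ltnW] xy; first exact: main.
by rewrite symc; apply: main.
Qed.

End PolygonDeletion.

(** * Nonuniversal elements and components of the graph *)

Section Graph.

Variables (n : nat) (D : {set {set 'I_n}}).

Let V := ~: universal_elements D.
Let G := graph_of D.

Lemma nonuniversalP (i : 'I_n) :
  reflect (exists2 j, j != i & [set i; j] \notin D) (i \in V).
Proof.
rewrite !inE negb_forall; apply: (iffP existsP) => -[j].
  by rewrite negb_imply => /andP[ji ijD]; exists j.
by move=> ji ijD; exists j; rewrite negb_imply ji.
Qed.

Lemma adj_graph_of (i j : 'I_n) :
  adj G i j = [&& i \in V, j \in V, i != j & [set i; j] \in D].
Proof.
rewrite /adj inE subUset !sub1set inE cards2 -/V.
by case: (i \in V); case: (j \in V); case: (i != j); case: (_ \in D).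
Qed.

Lemma componentsP (C : {set 'I_n}) :
  reflect (exists2 x, x \in V & C = [set y in V | connect (adj G) x y])
    (C \in components G).
Proof. exact: imsetP. Qed.

End Graph.

(** * Minors of a two-row matrix *)

Section Minors.

Variables (R : realType) (n : nat) (A : 'M[R]_(2, n)).

Lemma minor2E (i j : 'I_n) :
  minor2 A i j = A 0 i * A 1 j - A 0 j * A 1 i.
Proof.
rewrite /minor2 (expand_det_row _ 0) !big_ord_recl big_ord0 /cofactor !det_mx11.
rewrite !mxE !(tnth_nth i) /=.
have -> : lift 0 0 = 1 :> 'I_2 by apply/val_inj.
by rewrite /= /bump /=; ring.
Qed.

Lemma plucker (a b c d : 'I_n) :
  minor2 A a c * minor2 A b d =
  minor2 A a b * minor2 A c d + minor2 A a d * minor2 A b c.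
Proof. by rewrite !minor2E; ring. Qed.

Lemma minor2N (i j : 'I_n) : minor2 A i j = - minor2 A j i.
Proof. by rewrite !minor2E; ring. Qed.

Lemma minor2ii (i : 'I_n) : minor2 A i i = 0.
Proof. by rewrite minor2E; ring. Qed.

End Minors.

(** * From positroids to nice collections *)

Lemma positroid_nice (R : realType) (n : nat) (D : {set {set 'I_n}}) :
  positroid R (pairs 'I_n :\: D) -> nice D.
Proof.
case=> _ [A HA]; set V := ~: universal_elements D.
pose p := minor2 A.
have pos (i j : 'I_n) : (i < j)%N -> 0 <= p i j /\ (p i j == 0) = ([set i; j] \in D).
  move=> ij; have [Hpos H0] := HA i j ij.
  have ijP : [set i; j] \in pairs 'I_n by rewrite inE cards2 neq_ltn ij.
  move: Hpos H0; rewrite in_setD ijP andbT; case: (_ \in D) => /= Hpos H0.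
    by rewrite /p H0 // eqxx.
  by have := Hpos isT; rewrite lt0r => /andP[/negbTE].
have parD (i j : 'I_n) : i != j -> (p i j == 0) = ([set i; j] \in D).
  rewrite neq_ltn => /orP[/pos[]//|/pos[_]].
  by rewrite setUC /p minor2N oppr_eq0.
have parS (i j : 'I_n) : (p i j == 0) = (p j i == 0) by rewrite /p minor2N oppr_eq0.
(* A nonuniversal [b] has some [d] with [p b d] nonzero; the Plücker relation then reduces to
   [p a c * p b d = 0]. *)
have parT (a b c : 'I_n) : b \in V -> p a b == 0 -> p b c == 0 -> p a c == 0.
  case/nonuniversalP=> d db; rewrite -parD; last by rewrite eq_sym.
  move=> bd /eqP ab /eqP bc.
  have := plucker A a b c d; rewrite -/p ab bc mul0r mulr0 addr0 => /eqP.
  by rewrite mulf_eq0 (negbTE bd) orbF.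
have connP (x y : 'I_n) : connect (adj (graph_of D)) x y -> p x y == 0.
  have clo : closed (adj (graph_of D)) [pred z | p x z == 0].
    apply: intro_closed; first exact/sym_connect_sym/adj_sym.
    move=> z w; rewrite adj_graph_of => /and4P[zV wV zw]; rewrite -parD // !inE.
    by move=> H1 H2; apply: parT H2 H1.
  by move/(closed_connect clo); rewrite !inE /p minor2ii eqxx.
have parP (x y : 'I_n) : x \in V -> y \in V -> p x y == 0 ->
    connect (adj (graph_of D)) x y.
  move=> xV yV; have [->//|xy] := eqVneq x y; rewrite parD // => xyD.
  by apply: connect1; rewrite adj_graph_of xV yV xy.
split=> [C /componentsP[x xV ->] y z|[C [/componentsP[x xV CE]]]].
  move=> /setIdP[yV /connP xy] /setIdP[zV /connP xz] yz.
  rewrite adj_graph_of yV zV yz -parD //; apply: parT xV _ xz.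
  by rewrite parS.
apply; apply/connected_polygonP => a b c d aV bV cV dV /andP[ab bc] cd.
have inC y : y \in V -> (y \in C) = (p x y == 0).
  by move=> yV; rewrite CE; apply/setIdP/idP => [[_ /connP]|/parP]; auto.
apply/negP => /and3P[/eqP ac /eqP bd].
rewrite !inC // in ac bd * => abC.
have sameC y z : y \in V -> z \in V -> p y z == 0 -> (p x y == 0) = (p x z == 0).
  move=> yV zV yz; apply/idP/idP => H; first exact: parT yV H yz.
  by apply: (parT _ _ _ zV H); rewrite parS.
(* One of the pairs [a], [c] and [b], [d] lies in [C], hence is parallel through [x]. *)
have zero : p a c * p b d = 0.
  apply/eqP; rewrite mulf_eq0; move: abC.
  case: (boolP (p x a == 0)) ac => xa /esym xc; case: (boolP (p x b == 0)) bd => xb /esym xd // _.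
    by rewrite (parT a x c) // parS.
  by rewrite (parT b x d) ?orbT // parS.
have [ab0 _] := pos _ _ ab; have [bc0 _] := pos _ _ bc.
have [cd0 _] := pos _ _ cd; have [ad0 _] := pos _ _ (ltn_trans ab (ltn_trans bc cd)).
have := plucker A a b c d; rewrite -/p zero => /esym/eqP.
(* Already [p a b * p c d = 0] is contradictory: either factor vanishing would put [a] and [b], or
   [c] and [d], on the same side of [C]. *)
rewrite paddr_eq0 ?mulr_ge0 // => /andP[+ _]; rewrite mulf_eq0 => /orP[] H.
  by rewrite (sameC a b) ?eqxx in abC.
by rewrite ac bd (sameC c d) ?eqxx in abC.
Qed.

(** * From nice collections to a matrix *)

Lemma nice_positroid (R : realType) (n : nat) (D : {set {set 'I_n}}) :
  nice D -> positroid R (pairs 'I_n :\: D).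
Proof.
case=> complete connectedP; split; first exact: subsetDl.
set V := ~: universal_elements D.
pose cls (x : 'I_n) := [set y in V | connect (adj (graph_of D)) x y].
have symc := sym_connect_sym (@adj_sym _ (graph_of D)).
have inV (x y : 'I_n) : (y \in cls x) = (y \in V) && connect (adj (graph_of D)) x y.
  by apply/setIdP/andP.
(* Completeness of the components enters here, turning paths into members of [D]. *)
have clsD (i j : 'I_n) : i \in V -> j \in V -> i != j ->
    (j \in cls i) = ([set i; j] \in D).
  move=> iV jV ij; apply/setIdP/idP => [[_ conn]|ijD]; last first.
    by split=> //; apply: connect1; rewrite adj_graph_of iV jV ij.
  have clsC : cls i \in components (graph_of D) by apply/componentsP; exists i.
  have := complete _ clsC i j.
  rewrite !inV iV jV conn connect0 => /(_ isT isT ij).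
  by rewrite adj_graph_of => /and4P[].
have clsE (i j k : 'I_n) : j \in cls i -> (k \in cls i) = (k \in cls j).
  by rewrite !inV => /andP[_ ij]; rewrite (same_connect symc ij).
have clsS (i j : 'I_n) : i \in V -> j \in V -> (i \in cls j) = (j \in cls i).
  by move=> iV jV; rewrite !inV iV jV symc.
have clsI (i : 'I_n) : i \in V -> i \in cls i by rewrite inV => ->; rewrite connect0.
(* Niceness only denies disconnectedness; this suffices because crossing is a boolean condition. *)
have ncr (i : 'I_n) : i \in V -> noncrossing V (cls i).
  move=> iV a b c d aV bV cV dV abc cd; apply/negP => cross; apply: connectedP.
  exists (cls i); split; first by apply/componentsP; exists i.
  by move/connected_polygonP/(_ a b c d aV bV cV dV abc cd)/negP; apply.
have [V0|[v0 v0V]] := set_0Vmem V.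
  exists 0 => i j ij; rewrite minor2E !mxE mul0r subr0; split=> //.
  rewrite inE => /andP[ijD _].
  have : i \in V by apply/nonuniversalP; exists j; rewrite // neq_ltn ij orbT.
  by rewrite V0 inE.
pose a0 := [arg min_(i < v0 in V) (i : nat)].
have [a0V a0min] : a0 \in V /\ {in V, forall z : 'I_n, (a0 <= z)%N}.
  by rewrite /a0; case: arg_minnP.
pose m (i : 'I_n) := [arg min_(j < i in cls i) (j : nat)].
have mP (i : 'I_n) : i \in V ->
    [/\ m i \in cls i, m i \in V & {in cls i, forall z : 'I_n, (m i <= z)%N}].
  move=> iV; rewrite /m; case: arg_minnP; first exact: clsI.
  by move=> k kC kmin; split=> //; move: kC; rewrite inV => /andP[].
have mE (i j : 'I_n) : i \in V -> j \in V -> j \in cls i -> m i = m j.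
  move=> iV jV ij; have [mi _ mini] := mP i iV; have [mj _ minj] := mP j jV.
  apply/val_inj/eqP; rewrite eqn_leq mini ?minj //; first by rewrite -(clsE i).
  by rewrite (clsE i j).
pose C0 := cls a0.
(* Within [C0] this singles out the final segment, where the sign -1 makes minors with earlier
   columns of other classes positive. *)
pose last_part (i : 'I_n) := [exists j in V :\: C0, (j < i)%N].
pose A : 'M[R]_(2, n) := \matrix_(r, i)
  if i \notin V then 0 else
  if i \in C0 then (if r == 0 then (if last_part i then -1 else 1) else 0)
  else (if r == 0 then - (m i)%:R else 1).
have minor_pos (i j : 'I_n) : (i < j)%N -> i \in V -> j \in V -> j \notin cls i ->
    0 < minor2 A i j.
  move=> ij iV jV jni; rewrite minor2E !mxE iV jV /=.
  case: (boolP (i \in C0)) => iC0; case: (boolP (j \in C0)) => jC0.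
  - by rewrite -(clsE a0) ?jC0 in jni.
  - case: (boolP (last_part i)) => [/existsP[k /andP[/setDP[kV kC0] ki]]|_]; last first.
      by rewrite mulr1 mulr0 subr0 ltr01.
    (* If [i] were in the final segment, [a0 < k < i < j] would cross [C0]. *)
    have neq : a0 != k by apply: contraNneq kC0 => <-; apply: clsI.
    have a0k : (a0 < k)%N by rewrite ltn_neqAle neq a0min.
    have := ncr a0 a0V a0 k i j a0V kV iV jV.
    rewrite a0k ki => /(_ isT ij).
    by rewrite -/C0 iC0 (negbTE kC0) (negbTE jC0) /C0 clsI.
  - have -> : last_part j by apply/existsP; exists i; rewrite inE iC0 iV.
    by rewrite mulr0 sub0r mulr1 opprK ltr01.
  (* The minor is [m j - m i]. If [m j <= m i], then [a0 < m j < i < j] crosses the class of [j]. *)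
  rewrite !mulr1 opprK addrC subr_gt0 ltr_nat.
  have [mj mjV minj] := mP j jV; have [mi miV mini] := mP i iV.
  have mii := mini i (clsI i iV).
  have inj : i \notin cls j by rewrite clsS.
  rewrite ltnNge; apply/negP => le_mji.
  have a0m : (a0 < m j)%N.
    rewrite ltn_neqAle a0min // andbT; apply: contraNneq jC0 => /val_inj E.
    by rewrite /C0 E clsS.
  have mji : (m j < i)%N.
    rewrite ltn_neqAle (leq_trans le_mji mii) andbT.
    by apply: contraNneq inj => /val_inj <-.
  have := ncr j jV a0 (m j) i j a0V mjV iV jV.
  rewrite a0m mji => /(_ isT ij).
  rewrite mj (negbTE inj) clsI // clsS //.
  by rewrite -/C0 (negbTE jC0).
exists A => i j ij.
have ijP : [set i; j] \in pairs 'I_n by rewrite inE cards2 neq_ltn ij.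
have neq_ij : i != j by rewrite neq_ltn ij.
rewrite in_setD ijP andbT negbK; split=> ijD.
  have iV : i \in V by apply/nonuniversalP; exists j; rewrite 1?eq_sym.
  have jV : j \in V by apply/nonuniversalP; exists i; rewrite 1?setUC.
  by apply: minor_pos; rewrite // clsD.
rewrite minor2E !mxE.
case: (boolP (i \in V)) => iV; last by rewrite /= mul0r mulr0 subr0.
case: (boolP (j \in V)) => jV; last by rewrite /= mul0r mulr0 subr0.
rewrite -clsD // in ijD.
(* Both columns now fall under the same case: in [C0] their second entries vanish, elsewhere the
   columns are equal. *)
rewrite /= /C0 (clsS i a0) // (clsS j a0) // -(clsE i j a0 ijD).
case: ifP => _; first by rewrite !mulr0 subr0.
by rewrite (mE i j) // subrr.
Qed.

Theorem proposition3p9 (R : realType) (n : nat) (D : {set {set 'I_n}})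
    (n_ge2 : (2 <= n)%N) (D_pairs : D \subset pairs 'I_n) :
  positroid R (pairs 'I_n :\: D) <-> nice D.
Proof. by split; [exact: positroid_nice | exact: nice_positroid]. Qed.
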